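(* For each $\vec z\in\mathbb{R}^*$, neither of the functions $\mathrm{K}^{o}_{\vec z}:\mathbb{R}^*\to\mathbb{N}$ and $\mathrm{K}^{d}_{\vec z}:\mathbb{R}^*\to\mathbb{N}$ is computable by any BSS machine (with arbitrary real constants); this holds even for their restrictions to $\mathbb{R}^2$.
   Context: A BSS machine computes over $(\mathbb{R},+,-,\times,\div,<)$ with finitely many real constants, branching on signs; it computes a partial function $\mathbb{R}^*\to\mathbb{R}^*$, $\mathbb{R}^*=\bigcup_{n\ge0}\mathbb{R}^n$, $\operatorname{size}(\vec x)=n$ for $\vec x\in\mathbb{R}^n$; it decides a language $L\subseteq\mathbb{R}^*$ if it computes its characteristic function. Fix $\vec z=(z_1,\ldots,z_D)\in\mathbb{R}^*$. A BSS machine $M$ with control $\delta$ (discrete) referring to its own constants $c_1,\ldots,c_J$ and host constants $z_1,\ldots,z_D$ is encoded as $\langle M\rangle_{\vec z}:=(\langle\delta,c_1\rangle,c_2,\ldots,c_J)$, with $\langle\cdot,\cdot\rangle:\mathbb{N}\times\mathbb{R}\to\mathbb{R}$ a BSS-computable injective pairing with computable inverse. $\mathbb{U}_{\vec z}$ is a universal BSS machine with constants $\vec z$ simulating the encoded machine on given input (the empty program produces no output and halts only on empty input). $\mathrm{K}^{o}_{\vec z}(\vec x)$ is the minimum $\operatorname{size}(\vec p)$ over programs $\vec p\in\mathbb{R}^*$ such that $\mathbb{U}_{\vec z}$ with program $\vec p$ on empty input outputs $\vec x$ and terminates; $\mathrm{K}^{d}_{\vec z}(\vec x)$ is the minimum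 $\operatorname{size}(\vec p)$ such that $\mathbb{U}_{\vec z}$ with program $\vec p$ decides the one-element language $\{\vec x\}$. *)

(* Defs.v *)
From HB Require Import structures.
From mathcomp Require Import all_boot all_order all_algebra.
From mathcomp Require Import boolp classical_sets reals.

Set Implicit Arguments.
Unset Strict Implicit.
Unset Printing Implicit Defensive.

Import Order.TTheory GRing.Theory Num.Theory.

Local Open Scope ring_scope.
Local Open Scope classical_set_scope.

(* BSS machines are presented as random access machines over the reals:      *)
(* real registers Z_0, Z_1, ... and index registers I_0, I_1, ... holding    *)
(* natural numbers, the latter serving only for (indirect) addressing.  The  *)
(* control is a finite list of instructions; it refers to the real constants *)
(* of the machine by their positions only, so it is a discrete object.       *)
Inductive instr : Type :=
| Own   of nat & nat
| Host  of nat & nat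
| One   of nat
| Add   of nat & nat & nat
| Sub   of nat & nat & nat
| Mul   of nat & nat & nat
| Div   of nat & nat & nat
| Jpos  of nat & nat
| Copy  of nat & nat
| Izero of nat
| Iincr of nat
| Jieq  of nat & nat & nat.

Definition instr_code (a : instr) : nat * seq nat :=
  match a with
  | Own i k => (0, [:: i; k])
  | Host i k => (1, [:: i; k])
  | One i => (2, [:: i])
  | Add i j k => (3, [:: i; j; k])
  | Sub i j k => (4, [:: i; j; k])
  | Mul i j k => (5, [:: i; j; k])
  | Div i j k => (6, [:: i; j; k])
  | Jpos i l => (7, [:: i; l])
  | Copy i j => (8, [:: i; j])
  | Izero i => (9, [:: i])
  | Iincr i => (10, [:: i])
  | Jieq i j l => (11, [:: i; j; l])
  end%N.

Definition instr_decode (u : nat * seq nat) : option instr :=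
  match u with
  | (0, [:: i; k]) => Some (Own i k)
  | (1, [:: i; k]) => Some (Host i k)
  | (2, [:: i]) => Some (One i)
  | (3, [:: i; j; k]) => Some (Add i j k)
  | (4, [:: i; j; k]) => Some (Sub i j k)
  | (5, [:: i; j; k]) => Some (Mul i j k)
  | (6, [:: i; j; k]) => Some (Div i j k)
  | (7, [:: i; l]) => Some (Jpos i l)
  | (8, [:: i; j]) => Some (Copy i j)
  | (9, [:: i]) => Some (Izero i)
  | (10, [:: i]) => Some (Iincr i)
  | (11, [:: i; j; l]) => Some (Jieq i j l)
  | _ => None
  end%N.

Lemma instr_codeK : pcancel instr_code instr_decode.
Proof. by case. Qed.

HB.instance Definition _ := Countable.copy instr (pcan_type instr_codeK).

Definition control := seq instr.

Definition upd (T : Type) (f : nat -> T) (i : nat) (v : T) : nat -> T :=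
  fun j => if j == i then v else f j.

Record config (R : Type) := Config {
  pc  : nat;
  reg : nat -> R;
  idx : nat -> nat }.

Section Machine.
Variable R : realType.
Implicit Types (delta : control) (own host x y p z : seq R) (s : config R).

Definition exec own host (a : instr) (s : config R) : config R :=
  let: Config n Z X := s in
  match a with
  | Own i k => Config n.+1 (upd Z i own`_k) X
  | Host i k => Config n.+1 (upd Z i host`_k) X
  | One i => Config n.+1 (upd Z i 1) X
  | Add i j k => Config n.+1 (upd Z i (Z j + Z k)) X
  | Sub i j k => Config n.+1 (upd Z i (Z j - Z k)) X
  | Mul i j k => Config n.+1 (upd Z i (Z j * Z k)) X
  (* Division by zero is undefined: the machine is stuck and never halts. *)
  | Div i j k => if Z k == 0 then s else Config n.+1 (upd Z i (Z j / Z k)) X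
  | Jpos i l => Config (if 0 < Z i then l else n.+1) Z X
  | Copy i j => Config n.+1 (upd Z (X i) (Z (X j))) X
  | Izero i => Config n.+1 Z (upd X i 0%N)
  | Iincr i => Config n.+1 Z (upd X i (X i).+1)
  | Jieq i j l => Config (if X i == X j then l else n.+1) Z X
  end.

(* The machine halts when the program counter leaves the program. *)
Definition halted delta s : bool := (size delta <= pc s)%N.

Definition step delta own host s : config R :=
  if onth delta (pc s) is Some a then exec own host a s else s.

Definition init x : config R :=
  Config 0 (nth 0 x) (upd (fun=> 0%N) 0 (size x)).

Definition result s : seq R := mkseq (reg s) (idx s 0).

(* The graph of the partial function R^* -> R^* computed by the machine with *)
(* control delta, own constants own and host constants host.                 *)
Definition outputs delta own host x y : Prop :=
  exists t, let s := iter t (step delta own host) (init x) in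
    halted delta s /\ result s = y.

(* Computability, by a machine with arbitrary real constants, of the         *)
(* restriction to D of f; nothing is required of the machine outside D.      *)
Definition bss_computable_on (D : set (seq R)) (f : seq R -> seq R) : Prop :=
  exists delta (c : seq R), forall x, D x -> outputs delta c [::] x (f x).

Definition nat_bss_computable_on (D : set (seq R)) (f : seq R -> nat) : Prop :=
  bss_computable_on D (fun x => [:: (f x)%:R]).

Definition charfun (L : set (seq R)) x : seq R := [:: (x \in L)%:R].

Definition bss_pairing (pair : nat -> R -> R) : Prop :=
  [/\ forall n n' a a', pair n a = pair n' a' -> n = n' /\ a = a',
      exists delta (c : seq R), forall n a,
        outputs delta c [::] [:: n%:R; a] [:: pair n a]
    & exists delta (c : seq R), forall n a,
        outputs delta c [::] [:: pair n a] [:: n%:R; a]].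

Definition encode (pair : nat -> R -> R) delta (c1 : R) (cs : seq R) : seq R :=
  pair (pickle delta) c1 :: cs.

(* A program p and an input x are handed jointly to the universal machine as *)
(* the single vector (size p, p_1, ..., p_J, x_1, ..., x_n).                 *)
Definition join_input p x : seq R := (size p)%:R :: p ++ x.

(* The host constants z are the only constants of the universal machine.     *)
Definition runs U z p x y : Prop := outputs U [::] z (join_input p x) y.

Definition universal (pair : nat -> R -> R) z (U : control) : Prop :=
  [/\ forall delta c1 cs x y,
        runs U z (encode pair delta c1 cs) x y <->
        outputs delta (c1 :: cs) z x y,
      runs U z [::] [::] [::]
    & forall x y, runs U z [::] x y -> x = [::]].

(* The value 0 for empty A is a dummy: for universal U and a vector x, the   *)
(* machine whose own constants are the entries of x outputs x (or decides    *)
(* {x}), so the sets in Ko and Kd below are never empty.                     *)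
Definition min_size (A : set (seq R)) : nat :=
  if pselect (exists n, `[< exists2 p, A p & size p = n >]) is left e
  then ex_minn e else 0%N.

Definition Ko U z x : nat := min_size [set p | runs U z p [::] x].

Definition Kd U z x : nat :=
  min_size [set p | forall y, runs U z p y (charfun [set x] y)].

End Machine.

(* Main.v *)
From HB Require Import structures.
From mathcomp Require Import all_boot all_order all_algebra.
From mathcomp Require Import boolp classical_sets reals.
From mathcomp Require Import polyXY polyrcf ring zify.
From mathcomp Require Import functions cardinality.
From mathcomp Require Import topology normedtype derive lebesgue_measure.
Require Import Defs.

(* It suffices to treat inputs of length two. Suppose a machine M with constants
   d computes K. Choose (a, b) algebraically independent over d; then every sign
   test of M on (a, b) has the same outcome on all nearby inputs. If K(a, b) > 1,
   then K > 1 near (a, b); but K(a, q) <= 1 for every rational q, since one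
   constant a is enough to produce or to decide (a, q).

   It remains to choose (a, b) with K(a, b) > 1. If the one-entry program r
   outputs (a, b), then a is a rational function of r and z. If r decides
   {(a, b)}, then a is still algebraic over z and r: otherwise the accepting run
   would persist on a whole curve through (a, b), namely the locus of (a, b) over
   z and r. In both cases, when a is transcendental over z, exchange makes r
   algebraic over z and a. So only countably many r occur for a given a, and as r
   determines b, only countably many b have to be avoided. *)

Set Implicit Arguments.
Unset Strict Implicit.
Unset Printing Implicit Defensive.

Import Order.TTheory GRing.Theory Num.Theory.
Import numFieldNormedType.Exports.

Local Open Scope ring_scope.
Local Open Scope classical_set_scope.

(** * Rings generated by finitely many reals *)

Section Adjoin.
Variable R : realType.
Implicit Types (S : subringClosed R) (a c r x : R).

Definition adjoin (S : {pred R}) c : {pred R} :=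
  [pred v | `[< exists2 p, p \is a polyOver S & p.[c] = v >]].

Lemma adjoinP (S : {pred R}) c v :
  reflect (exists2 p, p \is a polyOver S & p.[c] = v) (v \in adjoin S c).
Proof. exact: asboolP. Qed.

Lemma adjoin_subring_closed S c : subring_closed (adjoin S c).
Proof.
split=> [|u v|u v].
- by apply/adjoinP; exists 1; rewrite ?rpred1// hornerC.
- move=> /adjoinP[p pS <-] /adjoinP[q qS <-]; apply/adjoinP.
  by exists (p - q); rewrite ?rpredB// !hornerE.
- move=> /adjoinP[p pS <-] /adjoinP[q qS <-]; apply/adjoinP.
  by exists (p * q); rewrite ?rpredM// !hornerE.
Qed.

HB.instance Definition _ S c :=
  GRing.isSubringClosed.Build R (adjoin S c) (adjoin_subring_closed S c).

Lemma mem_adjoin S c : c \in adjoin S c.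
Proof. by apply/adjoinP; exists 'X; rewrite ?polyOverX ?hornerX. Qed.

Lemma sub_adjoin S c : {subset S <= adjoin S c}.
Proof. by move=> v vS; apply/adjoinP; exists v%:P; rewrite ?polyOverC ?hornerC. Qed.

(** The ring generated by [cs] over the integers. A ring serves as well as a field: being algebraic
    over it or over its fraction field is the same. *)
Fixpoint ring_gen (cs : seq R) : subringClosed R :=
  if cs is c :: cs' then (adjoin (ring_gen cs') c : subringClosed R)
  else GRing.SubringClosed.clone R (@Num.int_num_subdef R) _.

Lemma mem_ring_gen cs c : c \in cs -> c \in ring_gen cs.
Proof.
elim: cs => //= d cs IH; rewrite inE => /predU1P[->|/IH]; first exact: mem_adjoin.
exact: sub_adjoin.
Qed.

Lemma nth_ring_gen cs k : cs`_k \in ring_gen cs.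
Proof.
have [lt_k|ge_k] := ltnP k (size cs); first exact/mem_ring_gen/mem_nth.
by rewrite nth_default// rpred0.
Qed.

(** * Algebraic dependence and exchange *)

Definition algebraic_over (S : {pred R}) a :=
  exists p : {poly R}, [/\ p \is a polyOver S, p != 0 & root p a].

Lemma transcendentalP (S : {pred R}) a : ~ algebraic_over S a ->
  forall p, p \is a polyOver S -> p.[a] = 0 -> p = 0.
Proof.
move=> Na p pS /eqP pa; apply: contra_notP Na => /eqP pn0.
by exists p.
Qed.

Lemma map_horner_polyOver2 S a (P : {poly {poly R}}) :
  P \is a polyOver (polyOver_pred S) ->
  map_poly (horner_eval a) P \is a polyOver (adjoin S a).
Proof.
move=> /polyOverP PS; apply/polyOverP => i; rewrite coef_map /=.
by apply/adjoinP; exists P`_i => //; apply: PS.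
Qed.

Lemma map_horner_eq0 S a (P : {poly {poly R}}) : ~ algebraic_over S a ->
  P \is a polyOver (polyOver_pred S) -> map_poly (horner_eval a) P = 0 -> P = 0.
Proof.
move=> Na /polyOverP PS P0; apply/polyP => i; rewrite coef0.
apply: (transcendentalP Na); first exact: PS.
by have := congr1 (fun p : {poly R} => p`_i) P0; rewrite coef_map coef0.
Qed.

(** Specialize the inner variable to [a] first: the result has the root [x], so it is zero, and then
    every coefficient of [P] vanishes at [a]. *)
Lemma algebraically_independent S a x (P : {poly {poly R}}) :
    ~ algebraic_over S a -> ~ algebraic_over (adjoin S a) x ->
  P \is a polyOver (polyOver_pred S) -> P.[x, a] = 0 -> P = 0.
Proof.
move=> Na Nx PS Pxa; apply: (map_horner_eq0 Na PS).
apply: (transcendentalP Nx); first exact: map_horner_polyOver2.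
by rewrite -horner_swapXY horner2_swapXY.
Qed.

Lemma swapXY_polyOver2 S (P : {poly {poly R}}) :
  P \is a polyOver (polyOver_pred S) -> swapXY P \is a polyOver (polyOver_pred S).
Proof.
move=> /polyOverP PS; apply/polyOverP => i; apply/polyOverP => j.
by rewrite coef_swapXY; have /polyOverP := PS j; apply.
Qed.

(** Steinitz exchange: the coefficients of the relation for [a] are values at [r], so it lifts to
    two variables over [S]. With the variables swapped it is a relation for [r], nonzero because [a]
    is transcendental. *)
Lemma algebraic_exchange S a r : ~ algebraic_over S a ->
  algebraic_over (adjoin S r) a -> algebraic_over (adjoin S a) r.
Proof.
move=> Na [p [/polyOverP pS p0 /eqP pa]].
have /choice[q qP] i : exists q, q \is a polyOver S /\ q.[r] = p`_i.
  by have /adjoinP[q] := pS i; exists q.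
pose P := \poly_(i < size p) q i.
have PS : P \is a polyOver (polyOver_pred S).
  apply/polyOverP => i; rewrite coef_poly.
  by case: ifP => _; [exact: (qP i).1|exact: rpred0].
have Pp : map_poly (horner_eval r) P = p.
  apply/polyP => i; rewrite coef_map coef_poly /=.
  case: ltnP => [_|hi]; first exact: (qP i).2.
  by rewrite /horner_eval horner0 nth_default.
have sS := swapXY_polyOver2 PS.
exists (map_poly (horner_eval a) (swapXY P)); split.
- exact: map_horner_polyOver2.
- apply/eqP => /(map_horner_eq0 Na sS) /eqP; rewrite swapXY_eq0 => /eqP P0.
  by move: p0; rewrite -Pp P0 rmorph0 eqxx.
- by apply/eqP; rewrite -horner_polyC -horner2_swapXY horner_swapXY Pp.
Qed.

(** * Countability *)

Lemma countable_polyOver S : countable [set` S] ->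
  countable [set p : {poly R} | p \is a polyOver S].
Proof.
move=> /pfcard_geP[S0|[f]].
  by have : [set` S] 0 := rpred0 S; rewrite S0.
(* As [f] enumerates [S], every polynomial over [S] comes from a finite sequence of indices. *)
pose g (s : seq nat) : {poly R} := Poly (map f s).
apply: (@sub_countable _ _ _ [set: seq nat]) => //.
apply: card_le_trans (card_image_le g _); apply: subset_card_le => p pS.
have fP v : v \in S -> exists n, f n = v.
  by move=> vS; have [n _ <-] := 'surj_f (vS : [set` S] v); exists n.
have [h hP] : exists h, forall v, v \in S -> f (h v) = v.
  have /choice[h hP] v : exists n, v \in S -> f n = v.
    by have [/fP[n <-]|] := boolP (v \in S); [exists n|exists 0%N].
  by exists h.
exists (map h p) => //; rewrite /g -map_comp -[RHS]polyseqK; congr Poly.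
rewrite -[RHS]map_id; apply/eq_in_map => v vp /=; apply: hP.
by move/allP: pS; apply.
Qed.

Lemma countable_ring_gen cs : countable [set` ring_gen cs].
Proof.
elim: cs => [|c cs IH] /=.
  apply: (@sub_countable _ _ _ [set: int]) => //.
  apply: card_le_trans (card_image_le (fun n : int => n%:~R : R) _).
  by apply: subset_card_le => v /intrP[n ->]; exists n.
apply: sub_countable (countable_polyOver IH).
apply: card_le_trans (card_image_le (fun p : {poly R} => p.[c]) _).
by apply: subset_card_le => v /adjoinP[p pS <-]; exists p.
Qed.

(** A countable union of finite sets of roots. *)
Lemma countable_algebraic_over S : countable [set` S] ->
  countable (algebraic_over S).
Proof.
move=> /countable_polyOver cS.
pose F (p : {poly R}) := [set a : R | p != 0 /\ root p a].
have: countable (\bigcup_(p in [set p | p \is a polyOver S]) F p).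
  apply: bigcup_countable => // p _.
  have [p0|p0] := eqVneq p 0.
    by apply: (@sub_countable _ _ _ set0) => //; apply: subset_card_le => a [];
      rewrite p0 eqxx.
  apply: finite_set_countable; apply: contrapT => /infinite_set_fset.
  move=> /(_ (size p))[X XF]; apply/negP; rewrite -ltnNge.
  apply: max_poly_roots => //; last exact: finmap.fset_uniq.
  by apply/allP => a /XF[].
apply: sub_countable; apply: subset_card_le => a [p [pS p0 pa]].
by exists p.
Qed.

(** Otherwise the unit ball would be countable, hence of Lebesgue measure zero. *)
Lemma countable_avoid (A : set R) : countable A -> exists x, ~ A x.
Proof.
move=> cA; apply: contrapT => /forallNP AT.
have : countable (ball (0 : R) 1).
  by apply: sub_countable cA; apply: subset_card_le => x _; exact: contrapT (AT x).
move=> /countable_lebesgue_measure0; rewrite lebesgue_measure_ball// => -[].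
by move/eqP; rewrite pnatr_eq0.
Qed.

End Adjoin.

(** * Runs that are uniform along a filter *)

Section LocalRuns.
Variables (R : realType) (T : Type) (G : set_system T).
Context {FG : Filter G}.
Variable P : set (T -> R).
Hypothesis P1 : P (fun=> 1).
Hypothesis PB : forall f g, P f -> P g -> P (fun t => f t - g t).
Hypothesis PM : forall f g, P f -> P g -> P (fun t => f t * g t).
(** This makes tests come out alike along [G]. It is used below for a single point, for all points
    near [(a, b)], and for the points near [(a, b)] on its locus. *)
Hypothesis P_sign : forall f, P f ->
  [\/ \forall t \near G, 0 < f t, \forall t \near G, f t < 0
    | \forall t \near G, f t = 0].

(** What a real register can hold: division leads out of [P], and denominators are nonzero only
    eventually along [G]. *)
Definition frac (h : T -> R) := exists f g,
  [/\ P f, P g & \forall t \near G, g t != 0 /\ h t = f t / g t].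

Let PD f g : P f -> P g -> P (fun t => f t + g t).
Proof.
move=> Pf Pg.
have -> : (fun t => f t + g t) = (fun t => f t - ((1 - 1) - g t)).
  by apply/funext => t; rewrite subrr sub0r opprK.
by do !apply: PB.
Qed.

Lemma frac_of f : P f -> frac f.
Proof.
move=> Pf; exists f, (fun=> 1); split=> //.
by apply: nearW => t; rewrite oner_neq0 divr1.
Qed.

Lemma fracD h k : frac h -> frac k -> frac (fun t => h t + k t).
Proof.
move=> [f [g [Pf Pg Hh]]] [f' [g' [Pf' Pg' Hk]]].
exists (fun t => f t * g' t + f' t * g t), (fun t => g t * g' t); split.
- by apply: PD; apply: PM.
- exact: PM.
- apply: filterS2 Hh Hk => t [g0 ->] [g'0 ->]; rewrite mulf_neq0//; split=> //.
  by field; rewrite g0 g'0.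
Qed.

Lemma fracB h k : frac h -> frac k -> frac (fun t => h t - k t).
Proof.
move=> [f [g [Pf Pg Hh]]] [f' [g' [Pf' Pg' Hk]]].
exists (fun t => f t * g' t - f' t * g t), (fun t => g t * g' t); split.
- by apply: PB; apply: PM.
- exact: PM.
- apply: filterS2 Hh Hk => t [g0 ->] [g'0 ->]; rewrite mulf_neq0//; split=> //.
  by field; rewrite g0 g'0.
Qed.

Lemma fracM h k : frac h -> frac k -> frac (fun t => h t * k t).
Proof.
move=> [f [g [Pf Pg Hh]]] [f' [g' [Pf' Pg' Hk]]].
exists (fun t => f t * f' t), (fun t => g t * g' t); split.
- exact: PM.
- exact: PM.
- apply: filterS2 Hh Hk => t [g0 ->] [g'0 ->]; rewrite mulf_neq0//; split=> //.
  by field; rewrite g0 g'0.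
Qed.

Lemma fracV h k : (\forall t \near G, k t != 0) -> frac h -> frac k ->
  frac (fun t => h t / k t).
Proof.
move=> k0 [f [g [Pf Pg Hh]]] [f' [g' [Pf' Pg' Hk]]].
exists (fun t => f t * g' t), (fun t => g t * f' t); split.
- exact: PM.
- exact: PM.
- apply: filterS3 k0 Hh Hk => t + [g0 ->] [g'0 E]; rewrite E => k0.
  have f'0 : f' t != 0 by apply: contraNneq k0 => ->; rewrite mul0r.
  rewrite mulf_neq0//; split=> //.
  by field; rewrite f'0 g'0 g0.
Qed.

(** [f / g] is [f * g], a member of [P], times the positive factor [g ^- 2]. *)
Lemma frac_sign h : frac h ->
  [\/ \forall t \near G, 0 < h t, \forall t \near G, h t < 0
    | \forall t \near G, h t = 0].
Proof.
move=> [f [g [Pf Pg Hh]]].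
have E t : g t != 0 -> f t / g t = (f t * g t) * (g t ^- 2).
  by move=> g0; field.
have pos t : g t != 0 -> 0 < g t ^- 2 by move=> g0; rewrite invr_gt0 exprn_even_gt0.
case: (P_sign (PM Pf Pg)) => Hs; [constructor 1|constructor 2|constructor 3];
  apply: filterS2 Hs Hh => t Hs [g0 ->]; rewrite E//.
- by rewrite mulr_gt0 ?pos.
- by rewrite pmulr_llt0 ?pos.
- by rewrite Hs mul0r.
Qed.

Variables (delta : control) (own host : seq R).
Hypothesis P_own : forall k, P (fun=> own`_k).
Hypothesis P_host : forall k, P (fun=> host`_k).

Lemma frac_upd F i h : (forall k, frac (F k)) -> frac h ->
  forall k, frac (upd F i h k).
Proof. by move=> FF Fh k; rewrite /upd; case: ifP. Qed.

Lemma upd_apply (F : nat -> T -> R) i h t :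
  (fun k => upd F i h k t) = upd (fun k => F k t) i (h t).
Proof. by apply/funext => k; rewrite /upd; case: ifP. Qed.

Definition locally_uniform (s : T -> config R) := exists n X F,
  (forall i, frac (F i)) /\
  \forall t \near G, s t = Config n (fun i => F i t) X.

(** Only [Div] and [Jpos] depend on the value of a real register to determine control, and only
    through its sign, which is constant along [G]. *)
Lemma locally_uniform_step s : locally_uniform s ->
  locally_uniform (fun t => step delta own host (s t)).
Proof.
move=> [n [X [F [FF Hs]]]].
case E : (onth delta n) => [a|]; last first.
  by exists n, X, F; split=> //; apply: filterS Hs => t ->; rewrite /step /= E.
have reg_upd i h : frac h ->
    (\forall t \near G, exec own host a (Config n (fun i => F i t) X)
      = Config n.+1 (upd (fun k => F k t) i (h t)) X) ->
    locally_uniform (fun t => step delta own host (s t)).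
  move=> Fh Ha; exists n.+1, X, (upd F i h); split; first exact: frac_upd.
  by apply: filterS2 Ha Hs => t Ha ->; rewrite /step [pc _]/= E Ha upd_apply.
have ctl n' X' : (\forall t \near G, exec own host a (Config n (fun i => F i t) X)
      = Config n' (fun i => F i t) X') ->
    locally_uniform (fun t => step delta own host (s t)).
  move=> Ha; exists n', X', F; split=> //.
  by apply: filterS2 Ha Hs => t Ha ->; rewrite /step [pc _]/= E Ha.
case: a E reg_upd ctl => [i k|i k|i|i j k|i j k|i j k|i j k|i l|i j|i|i|i j l] E
  reg_upd ctl /=.
- by apply: (reg_upd i (fun=> own`_k)); [exact/frac_of|apply: nearW].
- by apply: (reg_upd i (fun=> host`_k)); [exact/frac_of|apply: nearW].
- by apply: (reg_upd i (fun=> 1)); [exact/frac_of|apply: nearW].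
- by apply: (reg_upd i (fun t => F j t + F k t)); [exact/fracD|apply: nearW].
- by apply: (reg_upd i (fun t => F j t - F k t)); [exact/fracB|apply: nearW].
- by apply: (reg_upd i (fun t => F j t * F k t)); [exact/fracM|apply: nearW].
- have Fk0 : (\forall t \near G, F k t != 0) ->
      locally_uniform (fun t => step delta own host (s t)).
    move=> k0; apply: (reg_upd i (fun t => F j t / F k t)); first exact/fracV.
    by apply: filterS k0 => t /negPf /= ->.
  case: (frac_sign (FF k)) => Hk.
  + by apply: Fk0; apply: filterS Hk => t; apply: lt0r_neq0.
  + by apply: Fk0; apply: filterS Hk => t; apply: ltr0_neq0.
  (* Division by zero leaves the configuration unchanged. *)
  + by apply: (ctl n X); apply: filterS Hk => t /= ->; rewrite eqxx.
- case: (frac_sign (FF i)) => Hi.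
  + by apply: (ctl l X); apply: filterS Hi => t /= ->.
  + by apply: (ctl n.+1 X); apply: filterS Hi => t /= /lt_gtF ->.
  + by apply: (ctl n.+1 X); apply: filterS Hi => t /= ->; rewrite ltxx.
- by apply: (reg_upd (X i) (fun t => F (X j) t)); [exact: FF|apply: nearW].
- by apply: (ctl n.+1 (upd X i 0%N)); apply: nearW.
- by apply: (ctl n.+1 (upd X i (X i).+1)); apply: nearW.
- by apply: (ctl (if X i == X j then l else n.+1) X); apply: nearW.
Qed.

Lemma locally_uniform_run (x : T -> seq R) m k :
    (forall t, size (x t) = m) -> (forall i, P (fun t => (x t)`_i)) ->
  locally_uniform (fun t => iter k (step delta own host) (init (x t))).
Proof.
move=> sx Px; elim: k => [|k IH]; last exact: locally_uniform_step.
exists 0%N, (upd (fun=> 0%N) 0 m), (fun i t => (x t)`_i); split.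
  by move=> i; apply: frac_of.
by apply: nearW => t; rewrite /= /init sx.
Qed.

(* The base point t0 fixes the halting time and the output length. *)
Lemma locally_uniform_outputs (x : T -> seq R) m t0 y :
    (forall A, G A -> A t0) ->
    (forall t, size (x t) = m) -> (forall i, P (fun t => (x t)`_i)) ->
    outputs delta own host (x t0) y ->
  exists F : nat -> T -> R, (forall i, frac (F i)) /\
  \forall t \near G, outputs delta own host (x t) (mkseq (F^~ t) (size y)).
Proof.
move=> Gt0 sx Px [k []].
have [n [X [F [FF Hs]]]] := locally_uniform_run k sx Px.
rewrite (Gt0 _ Hs) => hlt <-; exists F; split=> //.
by apply: filterS Hs => t Hs; exists k; rewrite /= Hs size_mkseq.
Qed.

End LocalRuns.

(** * Determinism of runs *)

Section Determinism.
Variable R : realType.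
Implicit Types (delta : control) (own host x y : seq R) (s : config R).

Lemma iter_halted delta own host s k : halted delta s ->
  iter k (step delta own host) s = s.
Proof.
move=> hs; elim: k => //= k ->; rewrite /step.
by rewrite onth_default.
Qed.

Lemma outputs_inj delta own host x y y' :
  outputs delta own host x y -> outputs delta own host x y' -> y = y'.
Proof.
move=> [k [hk <-]] [k' [hk' <-]]; congr result.
have [kk'|/ltnW kk'] := leqP k k'.
  by rewrite -(subnK kk') iterD (iter_halted _ _ (k' - k) hk).
by rewrite -(subnK kk') iterD (iter_halted _ _ (k - k') hk').
Qed.

End Determinism.

(** * The locus of a point over a ring of constants *)

Section Curves.
Variable R : realType.
Implicit Types (S : subringClosed R) (a x : R) (P mu : {poly {poly R}}).

(* In [P.[t.2, t.1]] the outer variable of [P] is the second coordinate. *)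
Lemma continuous_horner2 P : continuous (fun t : R * R => P.[t.2, t.1]).
Proof.
elim/poly_ind: P => [|P c IH] t.
  rewrite (_ : (fun _ => _) = fun=> 0); first exact: cvg_cst.
  by apply/funext => u; rewrite !horner0.
rewrite (_ : (fun _ => _) = fun u => P.[u.2, u.1] * u.2 + c.[u.1]); last first.
  by apply/funext => u; rewrite !hornerE.
apply: (@cvgD _ _ _ (nbhs t)).
  by apply: (@cvgM _ _ (nbhs t)); [exact: IH|exact: cvg_snd].
by apply: (@cvg_comp _ _ _ fst (horner c)); [exact: cvg_fst|exact: continuous_horner].
Qed.

Definition polyfun S : set (R * R -> R) :=
  [set f | exists2 P, P \is a polyOver (polyOver_pred S) & f = fun t => P.[t.2, t.1]].

Lemma polyfun_cst S c : c \in S -> polyfun S (fun=> c).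
Proof.
move=> cS; exists c%:P%:P; first by rewrite !polyOverC.
by apply/funext => t; rewrite !hornerC.
Qed.

Lemma polyfun_fst S : polyfun S fst.
Proof.
exists 'X%:P; first by rewrite polyOverC polyOverX.
by apply/funext => t; rewrite hornerC hornerX.
Qed.

Lemma polyfun_snd S : polyfun S snd.
Proof.
exists 'X; first by rewrite polyOverX.
by apply/funext => t; rewrite hornerX hornerC.
Qed.

Lemma polyfunB S f g : polyfun S f -> polyfun S g -> polyfun S (fun t => f t - g t).
Proof.
move=> [P PS ->] [Q QS ->]; exists (P - Q); first by rewrite rpredB.
by apply/funext => t; rewrite !hornerE.
Qed.

Lemma polyfunM S f g : polyfun S f -> polyfun S g -> polyfun S (fun t => f t * g t).
Proof.
move=> [P PS ->] [Q QS ->]; exists (P * Q); first by rewrite rpredM.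
by apply/funext => t; rewrite !hornerE.
Qed.

(** Where [P] is nonzero at [t0], continuity keeps its sign; where it vanishes, the hypothesis on
    [G] applies. *)
Lemma polyfun_sign S (t0 : R * R) (G : set_system (R * R)) {FG : Filter G} :
    G --> t0 ->
    (forall P, P \is a polyOver (polyOver_pred S) -> P.[t0.2, t0.1] = 0 ->
      \forall t \near G, P.[t.2, t.1] = 0) ->
  forall f, polyfun S f ->
  [\/ \forall t \near G, 0 < f t, \forall t \near G, f t < 0
    | \forall t \near G, f t = 0].
Proof.
move=> Gt0 G0 f [P PS ->].
have cP : (fun t => P.[t.2, t.1]) @ G --> P.[t0.2, t0.1].
  by move=> A /(@continuous_horner2 P t0) /Gt0.
have [lt0|gt0|/(G0 _ PS)] := ltgtP P.[t0.2, t0.1] 0; last by constructor 3.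
- by constructor 2; exact: (cvgr_lt _ cP).
- by constructor 1; exact: (cvgr_gt _ cP).
Qed.

Lemma nbhs_neq a (B : set R) : nbhs a B -> exists2 a', a' != a & B a'.
Proof.
move=> aB; have : \forall a' \near a^', a' != a /\ B a'.
  near=> a'; split; near: a'; first exact: nbhs_dnbhs_neq.
  exact: nbhs_dnbhs.
by move=> /filter_ex[a' []]; exists a'.
Unshelve. all: by end_near. Qed.

(** The leading coefficient of [mu] need not be invertible, hence its power. Remainders still vanish
    at [(a, x)], so one shorter than [mu] is zero by minimality. *)
Lemma pseudo_division S a x mu :
    mu \is a polyOver (polyOver_pred S) -> mu.[x, a] = 0 -> mu != 0 ->
    (forall P, P \is a polyOver (polyOver_pred S) -> P.[x, a] = 0 ->
      (size P < size mu)%N -> P = 0) ->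
  forall P, P \is a polyOver (polyOver_pred S) -> P.[x, a] = 0 ->
  exists k Q, lead_coef mu ^+ k *: P = Q * mu.
Proof.
move=> muS mu0 mun0 min P; have [n] := ubnP (size P).
elim: n P => // n IH P szP PS P0.
have [lt|ge] := ltnP (size P) (size mu).
  by exists 0%N, 0; rewrite (min P)// scaler0 mul0r.
pose M := lead_coef P *: 'X^(size P - size mu) * mu.
have lcS Q : Q \is a polyOver (polyOver_pred S) -> lead_coef Q \is a polyOver S.
  by move=> /polyOverP; apply.
have [|||k [Q E]] := IH (lead_coef mu *: P - M).
- have mu_gt0 : (0 < size mu)%N by rewrite lt0n size_poly_eq0.
  have P_gt0 : (0 < size P)%N := leq_trans mu_gt0 ge.
  rewrite -ltnS (leq_trans _ szP)// ltnS -(prednK P_gt0) ltnS.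
  apply/leq_sizeP => j lej; rewrite coefB coefZ /M -scalerAl coefZ coefXnM.
  rewrite ltnNge (leq_trans _ lej) /=; last by rewrite -ltnS prednK// ltn_subrL mu_gt0.
  have [->|nej] := eqVneq j (size P).-1.
    rewrite (_ : _ - _ = (size mu).-1)%N; first by rewrite !lead_coefE mulrC subrr.
    by move: ge mu_gt0 P_gt0 {IH szP lej}; move: (size mu) (size P); lia.
  suff [? ?] : (size P <= j)%N /\ (size mu <= j - (size P - size mu))%N.
    by rewrite !nth_default ?mulr0 ?subr0.
  by move: ge mu_gt0 P_gt0 lej nej {IH szP}; move: (size mu) (size P); lia.
- by rewrite rpredB ?rpredM ?polyOverZ ?polyOverXn ?lcS.
- by rewrite /M !hornerE P0 mu0 !mulr0 subr0.
exists k.+1, (Q + lead_coef mu ^+ k *: (lead_coef P *: 'X^(size P - size mu))).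
by rewrite mulrDl -E scalerBr [_ *: (_ *: P)]scalerA -exprSr -scalerAl subrK.
Qed.

(** Split off the linear factor at [x]: the cofactor [q] takes the value of the derivative at [x],
    so it keeps its sign nearby while the linear factor changes sign. *)
Lemma simple_root_sign_change (f : {poly R}) x e :
    root f x -> f^`().[x] != 0 -> 0 < e ->
  exists h, [/\ 0 < h, h < e & f.[x - h] * f.[x + h] < 0].
Proof.
move=> /factor_theorem[q ->] + e0.
rewrite derivM derivXsubC !hornerE subrr mulr0 add0r => qx.
have : \forall y \near x, 0 < q.[y] * q.[x].
  have cq : (fun y => q.[y] * q.[x]) @ x --> q.[x] * q.[x].
    by apply: cvgM; [exact: continuous_horner|exact: cvg_cst].
  by apply: (cvgr_gt _ cq); rewrite -expr2 exprn_even_gt0.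
move=> /nbhs_ballP[d /= d0 qd].
pose h := Num.min d e / 2.
have m0 : 0 < Num.min d e by rewrite lt_min d0.
have h0 : 0 < h by rewrite divr_gt0.
have hm : h < Num.min d e by rewrite ltr_pdivrMr// ltr_pMr// ltr1n.
exists h; split=> //; first by rewrite (lt_le_trans hm)// ge_min lexx orbT.
have hd : h < d by rewrite (lt_le_trans hm)// ge_min lexx.
have q1 : 0 < q.[x - h] * q.[x].
  by apply: qd; rewrite /ball/= opprB addrC subrK gtr0_norm.
have q2 : 0 < q.[x + h] * q.[x].
  by apply: qd; rewrite /ball/= opprD addNKr normrN gtr0_norm.
rewrite !hornerM !hornerXsubC.
have -> : q.[x - h] * (x - h - x) * (q.[x + h] * (x + h - x)) =
  - ((q.[x - h] * q.[x]) * (q.[x + h] * q.[x]) * (h / q.[x]) ^+ 2).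
  by field.
rewrite oppr_lt0; apply: mulr_gt0; first exact: mulr_gt0.
by rewrite exprn_even_gt0//= mulf_neq0 ?invr_neq0// lt0r_neq0.
Qed.

(* [mu] has least degree in the outer variable among the polynomials over [S]
   vanishing at [(a, x)]. Pseudo-division by [mu] gives the second clause. By
   minimality [x] is a simple root of [mu] at [a], so it persists when [a] is
   moved, which gives the third clause. *)
Lemma exists_locus S a x : ~ algebraic_over S a -> exists mu,
  [/\ mu.[x, a] = 0,
      forall P, P \is a polyOver (polyOver_pred S) -> P.[x, a] = 0 ->
        \forall t \near (a, x), mu.[t.2, t.1] = 0 -> P.[t.2, t.1] = 0
    & forall A, nbhs (a, x) A ->
        exists t : R * R, [/\ A t, mu.[t.2, t.1] = 0 & t != (a, x)]].
Proof.
move=> Na.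
pose I P := [/\ P \is a polyOver (polyOver_pred S), P != 0 & P.[x, a] = 0].
have [exI|noI] := pselect (exists n, `[< exists2 P, I P & size P = n >]); last first.
  (* If only the zero polynomial vanishes at [(a, x)], the locus is the whole plane. *)
  exists 0; split=> [|P PS P0|A [[/= A1 A2] [A1a A2x] A12]]; first by rewrite !horner0.
    have -> : P = 0.
      apply: contra_notP noI => /eqP Pn0; exists (size P); apply/asboolP.
      by exists P.
    by apply: (@nearW _ (nbhs ((a, x) : R * R))) => t; rewrite !horner0.
  have [a' a'a A1a'] := nbhs_neq A1a.
  exists (a', x); split; [|by rewrite !horner0|by rewrite xpair_eqE negb_and a'a].
  by apply: A12; split=> //=; exact: nbhs_singleton.
case: (ex_minnP exI) => m /asboolP[mu [muS mun0 mu0] szmu] minm.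
have min P : P \is a polyOver (polyOver_pred S) -> P.[x, a] = 0 ->
    (size P < size mu)%N -> P = 0.
  move=> PS P0; rewrite szmu => lt; apply: contraTeq lt => Pn0; rewrite -leqNgt.
  by apply: minm; apply/asboolP; exists P.
have lcS : lead_coef mu \is a polyOver S by move/polyOverP: muS; apply.
(* A [mu] constant in the outer variable would make [a] algebraic. *)
have sz2 : (1 < size mu)%N.
  rewrite ltnNge; apply/negP => /size1_polyC E.
  move: mu0; rewrite E hornerC => /(transcendentalP Na) c0.
  move: mun0; rewrite E c0 ?eqxx//.
  by move/polyOverP: muS; apply.
(* The derivative is shorter than [mu]; vanishing here it would be zero, yet its top coefficient is
   a positive multiple of that of [mu]. *)
have dmu : mu^`().[x, a] != 0.
  apply/negP => /eqP /(min _ (polyOver_deriv muS)).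
  rewrite lt_size_deriv// => /(_ isT) /polyP /(_ (size mu).-2).
  rewrite coef_deriv coef0 prednK ?ltn_predRL// => /eqP.
  rewrite -scaler_nat scaler_eq0 pnatr_eq0 -lead_coefE lead_coef_eq0 (negPf mun0).
  by rewrite orbF; apply/negP; rewrite -lt0n ltn_predRL.
exists mu; split=> // [P PS P0|A [[/= A1 A2] [A1a A2x] A12]].
  have [k [Q E]] := pseudo_division muS mu0 mun0 min PS P0.
  (* As [a] is transcendental, the factor from pseudo-division is nonzero at [a], hence nearby, and
     cancels. *)
  have lca : (lead_coef mu).[a] != 0.
    apply/negP => /eqP /(transcendentalP Na) H; move: mun0.
    by rewrite -lead_coef_eq0 H ?eqxx.
  have : \forall t \near (a, x), (lead_coef mu).[t.1] != 0.
    have cl : (fun t : R * R => (lead_coef mu).[t.1]) @ (a, x) --> (lead_coef mu).[a].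
      by apply: (@cvg_comp _ _ _ fst (horner (lead_coef mu)));
        [exact: cvg_fst|exact: continuous_horner].
    exact: (cvgr_neq0 _ cl).
  apply: filterS => t lt mut.
  have := congr1 (fun p : {poly {poly R}} => p.[t.2, t.1]) E.
  rewrite /= !hornerE mut mulr0 => /eqP; rewrite mulf_eq0 => /orP[|/eqP//].
  by rewrite expf_eq0 (negPf lt) andbF.
have evE a' y : (map_poly (horner_eval a') mu).[y] = mu.[y, a'].
  by rewrite -horner_swapXY horner2_swapXY.
move: A2x => /nbhs_ballP[e /= e0 A2e].
have [||h [h0 he]] := @simple_root_sign_change (map_poly (horner_eval a) mu) x e _ _ e0.
- by rewrite /root evE mu0.
- by rewrite deriv_map -horner_swapXY horner2_swapXY.
rewrite !evE -hornerM => neg.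
(* The sign change survives a small move of [a]; the intermediate value theorem then gives a root
   over some [a'] other than [a]. *)
have : \forall a' \near a, A1 a' /\ (mu.[(x - h)%:P] * mu.[(x + h)%:P]).[a'] < 0.
  apply: filterI => //.
  by apply: (cvgr_lt _ (@continuous_horner _ _ a)).
move=> /nbhs_neq[a' a'a [A1a']]; rewrite hornerM -!evE => neg'.
have [|y yI /eqP y0] := poly_ivtoo _ neg'.
  by rewrite lerD2l ge0_cp// ltW.
exists (a', y); split.
- apply: A12; split=> //=; apply: A2e; rewrite /ball /=.
  have /itvP := yI; move=> {}yI; apply: lt_trans he.
  by rewrite distrC ltr_distl !yI.
- by rewrite /= -evE.
- by rewrite xpair_eqE negb_and a'a.
Qed.

End Curves.

(** * Explicit programs *)

Section Programs.
Variables (R : realType) (own host : seq R).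
Implicit Types (delta s : control) (c : config R) (Z : nat -> R) (X : nat -> nat).

Definition reaches delta c c' := exists k, iter k (step delta own host) c = c'.

Lemma reaches_refl delta c : reaches delta c c.
Proof. by exists 0%N. Qed.

Lemma reaches_trans delta c1 c2 c3 :
  reaches delta c1 c2 -> reaches delta c2 c3 -> reaches delta c1 c3.
Proof. by move=> [k <-] [l <-]; exists (l + k)%N; rewrite iterD. Qed.

Lemma reaches_step delta c a : onth delta (pc c) = Some a ->
  reaches delta c (exec own host a c).
Proof. by move=> E; exists 1%N; rewrite /= /step E. Qed.

Lemma onth_tail s s' j : onth (s ++ s') (size s + j) = onth s' j.
Proof. by rewrite onth_cat ltnNge leq_addr /= addKn. Qed.

Lemma outputs_reaches delta x c : reaches delta (init x) c -> halted delta c ->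
  outputs delta own host x (result c).
Proof. by move=> [k <-]; exists k. Qed.

(** Quantifying over the surrounding code and the index registers lets fragments be concatenated. *)
Definition falls s Z Z' := forall pre post X,
  reaches (pre ++ s ++ post) (Config (size pre) Z X)
    (Config (size pre + size s) Z' X).

Lemma falls_nil Z : falls [::] Z Z.
Proof. by move=> pre post X; rewrite addn0; exact: reaches_refl. Qed.

Lemma falls_cat s s' Z Z1 Z2 : falls s Z Z1 -> falls s' Z1 Z2 ->
  falls (s ++ s') Z Z2.
Proof.
move=> f1 f2 pre post X; rewrite -catA.
apply: reaches_trans (f1 pre (s' ++ post) X) _.
by rewrite size_cat addnA -size_cat catA; exact: f2.
Qed.

Lemma falls_cons a s Z Z1 Z2 :
    (forall n X, exec own host a (Config n Z X) = Config n.+1 Z1 X) ->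
  falls s Z1 Z2 -> falls (a :: s) Z Z2.
Proof.
move=> ea; apply: (@falls_cat [:: a]) => pre post X.
rewrite addn1 -ea; apply: reaches_step.
by rewrite /= -[size pre]addn0 onth_tail.
Qed.

Lemma falls_div i j k Z : Z k != 0 -> falls [:: Div i j k] Z (upd Z i (Z j / Z k)).
Proof.
move=> /negPf k0; apply: falls_cons; last exact: falls_nil.
by move=> n X /=; rewrite k0.
Qed.

Lemma falls_nseq_add n i k Z : k != i ->
  falls (nseq n (Add i i k)) Z (upd Z i (Z i + Z k *+ n)).
Proof.
move=> ki; elim: n Z => [|n IH] Z.
  rewrite mulr0n addr0 (_ : upd _ _ _ = Z); first exact: falls_nil.
  by apply/funext => j; rewrite /upd; case: eqP => // ->.
apply: falls_cons => [m X /=|]; first by [].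
suff -> : upd Z i (Z i + Z k *+ n.+1) =
    let Z1 := upd Z i (Z i + Z k) in upd Z1 i (Z1 i + Z1 k *+ n) by exact: IH.
apply/funext => j; rewrite /= /upd eqxx (negPf ki); case: eqP => // _.
by rewrite mulrS addrA.
Qed.

Lemma falls_nseq_sub n i k Z : k != i ->
  falls (nseq n (Sub i i k)) Z (upd Z i (Z i - Z k *+ n)).
Proof.
move=> ki; elim: n Z => [|n IH] Z.
  rewrite mulr0n subr0 (_ : upd _ _ _ = Z); first exact: falls_nil.
  by apply/funext => j; rewrite /upd; case: eqP => // ->.
apply: falls_cons => [m X /=|]; first by [].
suff -> : upd Z i (Z i - Z k *+ n.+1) =
    let Z1 := upd Z i (Z i - Z k) in upd Z1 i (Z1 i - Z1 k *+ n) by exact: IH.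
apply/funext => j; rewrite /= /upd eqxx (negPf ki); case: eqP => // _.
by rewrite mulrS opprD addrA.
Qed.

(* Registers 0 and 1 are reserved for the input. *)
Definition loads s (a b : R) := forall Z, (forall i, (2 <= i)%N -> Z i = 0) ->
  exists2 Z', falls s Z Z' & [/\ Z' 0 = Z 0, Z' 1 = Z 1, Z' 2 = a & Z' 3 = b]%N.

Lemma exec_tail s tl j n Z X c a : n = (size s + j)%N -> onth tl j = Some a ->
  reaches (s ++ tl) (exec own host a (Config n Z X)) c ->
  reaches (s ++ tl) (Config n Z X) c.
Proof.
move=> -> E; apply: reaches_trans; apply: reaches_step.
by rewrite /= onth_tail.
Qed.

Ltac run_tail s tl j :=
  refine (@exec_tail s tl j _ _ _ _ _ _ (erefl _) _) => /=;
    [by rewrite ?add0n ?addn0 ?addnS ?addn0|].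

Lemma loads_outputs s a b : loads s a b ->
  exists delta, outputs delta own host [::] [:: a; b].
Proof.
(* On empty input registers 0 and 1 are zero, so adding copies [a] and [b] there; the increments set
   the output length to 2. *)
move=> ls; pose tl := [:: Add 0 0 2; Add 1 1 3; Iincr 0; Iincr 0]%N.
have [|Z' fs [Z0 Z1 Z2 Z3]] := ls (nth 0 [::]); first by move=> i; rewrite nth_nil.
exists (s ++ tl).
suff [c [H1 H2 <-]] : exists c, [/\ reaches (s ++ tl) (init [::]) c,
    halted (s ++ tl) c & result c = [:: a; b]] by exact: outputs_reaches.
eexists; split.
- apply: reaches_trans (fs [::] tl (upd (fun=> 0%N) 0 0)) _.
  run_tail s tl 0%N. run_tail s tl 1%N. run_tail s tl 2%N. run_tail s tl 3%N.
  exact: reaches_refl.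
- by rewrite /halted /= size_cat /= add0n addn4.
- by rewrite /result /= /mkseq /= /upd /= Z0 Z1 Z2 Z3 /= !add0r.
Qed.

Lemma loads_decides s a b : loads s a b ->
  exists delta, forall y, outputs delta own host y (charfun [set [:: a; b]] y).
Proof.
move=> ls.
(* [hd] tests for input length 2; its positions 3 to 6 reject and jump to the end. From 7 on [s]
   loads [a] and [b], and [tl] goes back to 3 if the squared distance to the input is positive, else
   accepts. *)
pose tl := [:: Sub 2 2 0; Sub 3 3 1; Mul 2 2 2; Mul 3 3 3; Add 2 2 3; Jpos 2 3;
  One 0; Izero 0; Iincr 0]%N.
pose hd := [:: Iincr 1; Iincr 1; Jieq 0 1 7; Sub 0 0 0; Izero 0; Iincr 0;
  Jieq 0 0 (16 + size s)]%N.
pose delta := hd ++ s ++ tl; exists delta => y.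
have sz : size delta = (16 + size s)%N by rewrite !size_cat /= addnCA addnC.
suff [c [H1 H2 <-]] : exists c, [/\ reaches delta (init y) c,
    halted delta c & result c = charfun [set [:: a; b]] y].
  exact: outputs_reaches.
have reject Z X : y != [:: a; b] -> exists c, [/\ reaches delta (Config 3 Z X) c,
    halted delta c & result c = charfun [set [:: a; b]] y].
  move=> yab; eexists; split.
  - run_tail (@nil instr) delta 3%N. run_tail (@nil instr) delta 4%N.
    run_tail (@nil instr) delta 5%N. run_tail (@nil instr) delta 6%N.
    exact: reaches_refl.
  - by rewrite /halted sz.
  - rewrite /result /= /charfun /mkseq /= /upd /= subrr; congr [:: _].
    by rewrite memNset//; exact/eqP.
pose X := (upd (upd (upd (fun=> 0) 0 (size y)) 1 1) 1 2)%N.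
have start : reaches delta (init y)
    (Config (if size y == 2 then 7 else 3)%N (nth 0 y) X).
  run_tail (@nil instr) delta 0%N. run_tail (@nil instr) delta 1%N.
  run_tail (@nil instr) delta 2%N. exact: reaches_refl.
have [sy|sy] := eqVneq (size y) 2%N; last first.
  rewrite (negPf sy) in start.
  have [|c [H1 H2 H3]] := reject (nth 0 y) X; last first.
    exists c; split=> //; exact: reaches_trans start H1.
  by apply: contraNneq sy => ->.
move: X start; case: y sy reject => [|y0 [|y1 []]]// _ reject X start.
have [|Z' fs [/= Z0 Z1 Z2 Z3]] := ls (nth 0 [:: y0; y1]).
  by case=> [|[|i]]//= _; rewrite nth_nil.
pose d := (a - y0) * (a - y0) + (b - y1) * (b - y1).
have mid : exists Z'' , Z'' 0%N = y0 /\ reaches delta (init [:: y0; y1])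
    (Config (if 0 < d then 3%N else (7 + size s).+4.+2) Z'' X).
  eexists; split; last first.
    apply: reaches_trans start _.
    apply: reaches_trans (fs hd tl X) _.
    rewrite /delta catA /=.
    run_tail (hd ++ s) tl 0%N. run_tail (hd ++ s) tl 1%N.
    run_tail (hd ++ s) tl 2%N. run_tail (hd ++ s) tl 3%N.
    run_tail (hd ++ s) tl 4%N. run_tail (hd ++ s) tl 5%N.
    rewrite /upd /= Z0 Z1 Z2 Z3 -/d; exact: reaches_refl.
  by rewrite /upd /=.
move: mid; case: ltP => [d0|dle0] [Z'' [Z''0 mid]].
  have [|c [H1 H2 H3]] := reject Z'' X; last first.
    by exists c; split=> //; exact: reaches_trans mid H1.
  by apply: contraTneq d0 => -[y0a y1b]; rewrite /d y0a y1b !subrr !mul0r addr0 ltxx.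
have [y0a y1b] : y0 = a /\ y1 = b.
  move: dle0; rewrite /d -!expr2 => dle0.
  have /eqP : (a - y0) ^+ 2 + (b - y1) ^+ 2 = 0.
    by apply/le_anti; rewrite dle0 addr_ge0 ?sqr_ge0.
  rewrite paddr_eq0 ?sqr_ge0// !sqrf_eq0 !subr_eq0.
  by move=> /andP[/eqP-> /eqP->].
eexists; split.
- apply: reaches_trans mid _.
  rewrite /delta catA.
  run_tail (hd ++ s) tl 6%N. run_tail (hd ++ s) tl 7%N.
  run_tail (hd ++ s) tl 8%N. exact: reaches_refl.
- by rewrite /halted sz.
- rewrite /result /= /charfun /mkseq /= /upd /=; congr [:: _].
  by rewrite y0a y1b mem_set.
Qed.

End Programs.

Lemma loads_own (R : realType) (a b : R) host : loads [:: a; b] host [:: Own 2 0; Own 3 1] a b.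
Proof.
move=> Z Z0; eexists.
  apply: falls_cons => //=; apply: falls_cons => //=; exact: falls_nil.
by [].
Qed.

(** Register 4 holds 1, from which the numerator is built in 3 and the denominator in 5: a rational
    second coordinate costs no constant. *)
Lemma loads_rat (R : realType) (a : R) host n k m :
  loads [:: a] host (Own 2 0 :: One 4 :: nseq n (Add 3 3 4)
    ++ nseq k (Sub 3 3 4) ++ nseq m.+1 (Add 5 5 4) ++ [:: Div 3 3 5])
    a ((n%:R - k%:R) / m.+1%:R).
Proof.
move=> Z Z0; eexists.
  apply: falls_cons => //; apply: falls_cons => //.
  apply: falls_cat; first exact: falls_nseq_add.
  apply: falls_cat; first exact: falls_nseq_sub.
  apply: falls_cat; first exact: falls_nseq_add.
  by apply: falls_div; rewrite /upd /= Z0// add0r pnatr_eq0.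
by rewrite /upd /= (Z0 3%N)// (Z0 5%N)// !add0r.
Qed.

(** * Program size *)

Section Complexity.
Variable R : realType.
Implicit Types (a b r : R) (z : seq R).

(** Uniform runs over a one-point parameter space: registers hold quotients of elements of the ring
    generated by [z] and [r], so [a] is a root of a linear polynomial over it. *)
Lemma output1_algebraic (U : control) z r a b :
  runs U z [:: r] [::] [:: a; b] -> algebraic_over (adjoin (ring_gen z) r) a.
Proof.
move=> Uab; set S := adjoin _ r.
pose P : set (unit -> R) := [set f | f tt \in S].
have Pinput i : P (fun=> [:: 1; r]`_i).
  by case: i => [|[|i]]; rewrite /P /=; [exact: rpred1|exact: mem_adjoin|
    rewrite nth_nil; exact: rpred0].
have [||||||||||F [FF Ft]] := @locally_uniform_outputs R unit (globally [set: unit]) _ P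
  _ _ _ _ U [::] z _ _ (fun=> [:: 1; r]) 2 tt [:: a; b].
- exact: rpred1.
- by move=> f g; exact: rpredB.
- by move=> f g; exact: rpredM.
- move=> f _; have [lt|gt|eq] := ltgtP (f tt) 0.
  + by constructor 2 => -[].
  + by constructor 1 => -[].
  + by constructor 3 => -[].
- by move=> k; rewrite /P /= nth_nil; exact: rpred0.
- by move=> k; apply: sub_adjoin; exact: nth_ring_gen.
- by move=> A; apply.
- by [].
- exact: Pinput.
- exact: Uab.
have /= := outputs_inj Uab (Ft tt I); rewrite /mkseq /= => -[aF _].
have [f [g [Pf Pg /(_ tt I)[g0 E]]]] := FF 0%N.
exists ((g tt)%:P * 'X - (f tt)%:P); split.
- by rewrite rpredB ?rpredM ?polyOverC ?polyOverX.
- apply: contraNneq g0 => /polyP /(_ 1%N).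
  by rewrite coefB coefCM coefX coefC mulr1 subr0 coef0 => ->.
- by rewrite /root !hornerE aF E mulrC divfK ?subrr.
Qed.

(* If [a] were transcendental, the accepting run on [(a, b)] would persist along
   the locus of [(a, b)] over the ring of constants. *)
Lemma decide1_algebraic (U : control) z r a b :
    (forall y, runs U z [:: r] y (charfun [set [:: a; b]] y)) ->
  algebraic_over (adjoin (ring_gen z) r) a.
Proof.
move=> Uab; pose S : subringClosed R := adjoin (ring_gen z) r.
apply: contrapT => Na.
have [mu [mu0 muP mu_ne]] := @exists_locus _ S a b Na.
(* Along this filter, polynomials over [S] vanishing at [(a, b)] stay zero, by [muP]. *)
pose G := within [set t : R * R | mu.[t.2, t.1] = 0] (nbhs (a, b)).
have Gt0 A : G A -> A (a, b) by move=> /nbhs_singleton; apply.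
pose x (t : R * R) := [:: 1; r; t.1; t.2].
have FG : Filter G by exact: within_filter.
have cG : G --> ((a, b) : R * R) by exact: cvg_within.
have Gsign := @polyfun_sign R S (a, b) G FG cG muP.
have [||||||F [FF Ft]] := @locally_uniform_outputs R _ G _ (polyfun S)
  _ (@polyfunB _ S) (@polyfunM _ S) Gsign U [::] z _ _ x 4 (a, b) [:: 1] Gt0.
- exact/polyfun_cst/rpred1.
- by move=> k; apply: polyfun_cst; rewrite nth_nil rpred0.
- by move=> k; apply: polyfun_cst; apply: sub_adjoin; exact: nth_ring_gen.
- by [].
- case=> [|[|[|[|i]]]] /=.
  + exact/polyfun_cst/rpred1.
  + exact/polyfun_cst/mem_adjoin.
  + exact: polyfun_fst.
  + exact: polyfun_snd.
  + by apply: polyfun_cst; rewrite nth_nil rpred0.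
- by have := Uab [:: a; b]; rewrite /charfun mem_set.
have F0E : \forall t \near G, F 0%N t = ([:: t.1; t.2] \in [set [:: a; b]])%:R.
  by apply: filterS Ft => t /(outputs_inj (Uab [:: t.1; t.2])) [].
have F01 : F 0%N (a, b) = 1 by rewrite (Gt0 _ F0E) mem_set.
case: (frac_sign (@polyfunM _ S) Gsign (FF 0%N)) => [Fpos|/Gt0|/Gt0].
(* A positive answer is acceptance, so all nearby points of the locus would equal [(a, b)]. *)
- have /mu_ne[t [tE mut]] : \forall t \near G, t = (a, b).
    apply: filterS2 F0E Fpos => -[a' b'] /= ->.
    case: (boolP (_ \in _)); last by rewrite ltxx.
    by rewrite inE /= => -[-> ->].
  by rewrite tE ?eqxx.
- by rewrite /= F01 ltr10.
- by rewrite /= F01 => /eqP; rewrite oner_eq0.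
Qed.

Lemma nbhs_rat a b (A : set (R * R)) : nbhs (a, b) A ->
  exists q : rat, A (a, ratr q).
Proof.
move=> [[/= A1 A2] [A1a /nbhs_ballP[e /= e0 A2e]] A12].
have /rat_in_itvoo[q /itvP qI] : b - e < b + e by rewrite ltrD2l gt0_cp.
exists q; apply: A12; split=> /=; first exact: nbhs_singleton.
by apply: A2e; rewrite /ball /= distrC ltr_distl !qI.
Qed.

(* [Q r a b] stands for: the one-entry program [r] outputs, or decides, [(a, b)]. *)
Lemma not_computable_of_generic (K : seq R -> nat) z (Q : R -> R -> R -> Prop) :
    (forall r a b b', Q r a b -> Q r a b' -> b = b') ->
    (forall r a b, Q r a b -> algebraic_over (adjoin (ring_gen z) r) a) ->
    (forall a b, (K [:: a; b] <= 1)%N -> exists r, Q r a b) ->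
    (forall a q, (K [:: a; ratr q] <= 1)%N) ->
  ~ nat_bss_computable_on [set x : seq R | size x = 2%N] K.
Proof.
move=> Qfun Qalg KQ Krat [delta [d Kd]].
(* Transcendence over [z] serves exchange, over [d] the uniformity of the run. *)
have [a] : exists a, ~ (algebraic_over (ring_gen z) `|` algebraic_over (ring_gen d)) a.
  apply: countable_avoid; rewrite -bigcup2E; apply: bigcup_countable => // i _.
  rewrite /bigcup2; case: i => [|[|i]] //=;
    exact/countable_algebraic_over/countable_ring_gen.
move=> /not_orP[az ad].
(* [B] is countable: countably many [r], each with at most one [b]. *)
pose B := \bigcup_(r in algebraic_over (adjoin (ring_gen z) a)) [set b | Q r a b].
have [b] : exists b, ~ (algebraic_over (adjoin (ring_gen d) a) `|` B) b.
  apply: countable_avoid; rewrite -bigcup2E; apply: bigcup_countable => // i _.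
  rewrite /bigcup2; case: i => [|[|i]] //=.
    exact/countable_algebraic_over/(countable_ring_gen (a :: d)).
  apply: bigcup_countable => [|r _].
    exact/countable_algebraic_over/(countable_ring_gen (a :: z)).
  have [[b0 Qb0]|NQ] := pselect (exists b, Q r a b).
    apply: (@sub_countable _ _ _ [set b0]) => //.
    by apply: subset_card_le => b /= /(Qfun _ _ _ _ Qb0).
  apply: (@sub_countable _ _ _ set0) => //; apply: subset_card_le => b Qb.
  by apply: NQ; exists b.
move=> /not_orP[bd bB].
have K2 : (1 < K [:: a; b])%N.
  rewrite ltnNge; apply/negP => /KQ[r Qr]; apply: bB; exists r => //.
  exact: algebraic_exchange (Qalg _ _ _ Qr).
pose S := ring_gen d.
pose G : set_system (R * R) := nbhs (a, b).
have FG : Filter G by exact: nbhs_filter.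
have Gt0 A : G A -> A (a, b) by exact: nbhs_singleton.
have Gsign : forall f, polyfun S f ->
    [\/ \forall t \near G, 0 < f t, \forall t \near G, f t < 0
      | \forall t \near G, f t = 0].
  have cG : G --> ((a, b) : R * R) by exact: cvg_id.
  apply: (@polyfun_sign R S (a, b) _ _ cG) => P PS P0.
  rewrite (algebraically_independent ad bd PS P0).
  by apply: (@nearW _ G) => t; rewrite !horner0.
have [||||||F [FF Ft]] := @locally_uniform_outputs R _ G _ (polyfun S)
  _ (@polyfunB _ S) (@polyfunM _ S) Gsign delta d [::] _ _ (fun t => [:: t.1; t.2]) 2
  (a, b) [:: (K [:: a; b])%:R] Gt0.
- exact/polyfun_cst/rpred1.
- by move=> k; apply: polyfun_cst; exact: nth_ring_gen.
- by move=> k; apply: polyfun_cst; rewrite nth_nil rpred0.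
- by [].
- case=> [|[|i]] /=.
  + exact: polyfun_fst.
  + exact: polyfun_snd.
  + by apply: polyfun_cst; rewrite nth_nil rpred0.
- exact: Kd.
have F0E : \forall t \near G, F 0%N t = (K [:: t.1; t.2])%:R.
  by apply: filterS Ft => t /(outputs_inj (Kd [:: t.1; t.2] erefl)) [].
have F01 : 0 < F 0%N (a, b) - 1.
  by rewrite (Gt0 _ F0E) /= subr_gt0 ltr1n.
have P1 : polyfun S (fun=> 1) by exact/polyfun_cst/rpred1.
(* Subtracting 1 turns [K > 1] into a sign, constant near [(a, b)]. *)
have FB : frac G (polyfun S) (fun t => F 0%N t - 1).
  by apply: fracB => //; [exact: polyfunB|exact: polyfunM|exact: frac_of].
case: (frac_sign (@polyfunM _ S) Gsign FB) => /= [Fpos|/Gt0|/Gt0].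
- have /nbhs_rat[q] : \forall t \near G, (1 < K [:: t.1; t.2])%N.
    by apply: filterS2 F0E Fpos => t ->; rewrite subr_gt0 ltr1n.
  by rewrite /= ltnNge Krat.
- by rewrite /= (lt_gtF F01).
- by rewrite /= => E; rewrite E ltxx in F01.
Qed.

(** * Minimal programs for the universal machine *)

Lemma min_size_le (A : set (seq R)) p : A p -> (min_size A <= size p)%N.
Proof.
move=> Ap; rewrite /min_size; case: pselect => // e.
by case: ex_minnP => m _; apply; apply/asboolP; exists p.
Qed.

Lemma min_sizeP (A : set (seq R)) p : A p -> exists2 p', A p' & size p' = min_size A.
Proof.
move=> Ap; rewrite /min_size; case: pselect => [e|[]].
  by case: ex_minnP => m /asboolP.
by exists (size p); apply/asboolP; exists p.
Qed.

Variables (pair : nat -> R -> R) (z : seq R) (U : control).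
Hypothesis UP : universal pair z U.

Lemma rat_loads a (q : rat) : exists s, loads [:: a] z s a (ratr q).
Proof.
have [n [k [m E]]] : exists n k m, q = (n%:R - k%:R) / m.+1%:R :> rat.
  have d0 : (`|denq q|.-1.+1)%:R = (denq q)%:~R :> rat.
    by rewrite prednK ?absz_gt0// natr_absz gtr0_norm.
  (* [m.+1] is the denominator; [Negz n] stands for [- n.+1], whence the value of [k]. *)
  case En : (numq q) => [n|n].
    by exists n, 0%N, `|denq q|.-1; rewrite d0 -{1}[q]divq_num_den En subr0.
  by exists 0%N, n.+1, `|denq q|.-1; rewrite d0 -{1}[q]divq_num_den En NegzE sub0r rmorphN.
eexists; rewrite E rmorphM fmorphV rmorphB !rmorph_nat; exact: loads_rat.
Qed.

Lemma not_computable_Ko :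
  ~ nat_bss_computable_on [set x : seq R | size x = 2%N] (Ko U z).
Proof.
have [Uenc U0 _] := UP.
apply: (@not_computable_of_generic _ z (fun r a b => runs U z [:: r] [::] [:: a; b])).
- by move=> r a b b' H H'; have [] := outputs_inj H H'.
- exact: output1_algebraic.
(* The machine with constants [a] and [b] shows that the minimum is attained, not the default 0. The
   empty program outputs the empty vector, so size at most one means one entry. *)
- move=> a b; rewrite /Ko; have [delta dP] := loads_outputs (loads_own a b z).
  have /min_sizeP[p pP <-] : [set p | runs U z p [::] [:: a; b]] (encode pair delta a [:: b]).
    exact/Uenc.
  case: p pP => [|r [|? ?]] //= rP _; last by exists r.
  by have := outputs_inj U0 rP.
- move=> a q; have [s /loads_outputs[delta dP]] := rat_loads a q.
  apply: (@min_size_le _ (encode pair delta a [::])); exact/Uenc.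
Qed.

Lemma not_computable_Kd :
  ~ nat_bss_computable_on [set x : seq R | size x = 2%N] (Kd U z).
Proof.
have [Uenc _ U0] := UP.
apply: (@not_computable_of_generic _ z
  (fun r a b => forall y, runs U z [:: r] y (charfun [set [:: a; b]] y))).
(* The answer on [(a, b)] is 1, so [(a, b)] lies in the second singleton too. *)
- move=> r a b b' H H'; have [] := outputs_inj (H [:: a; b]) (H' [:: a; b]).
  rewrite mem_set//; case: (boolP (_ \in _)) => [|_ /eqP]; last by rewrite oner_eq0.
  by rewrite inE => -[].
- exact: decide1_algebraic.
- move=> a b; rewrite /Kd; have [delta dP] := loads_decides (loads_own a b z).
  have /min_sizeP[p pP <-] : [set p | forall y, runs U z p y (charfun [set [:: a; b]] y)]
      (encode pair delta a [:: b]).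
    by move=> y; exact/Uenc.
  case: p pP => [|r [|? ?]] //= rP _; last by exists r.
  (* The empty program halts only on empty input, so it decides no language. *)
  by have := U0 _ _ (rP [:: a]).
- move=> a q; have [s /loads_decides[delta dP]] := rat_loads a q.
  by apply: (@min_size_le _ (encode pair delta a [::])) => y; exact/Uenc.
Qed.

End Complexity.

Theorem theorem2 (R : realType) (pair : nat -> R -> R)
    (pairP : bss_pairing pair) (z : seq R) (U : control)
    (UP : universal pair z U) :
  [/\ ~ nat_bss_computable_on [set: seq R] (Ko U z),
      ~ nat_bss_computable_on [set: seq R] (Kd U z),
      ~ nat_bss_computable_on [set x : seq R | size x = 2%N] (Ko U z)
    & ~ nat_bss_computable_on [set x : seq R | size x = 2%N] (Kd U z)].
Proof.
have restrict K : ~ nat_bss_computable_on [set x : seq R | size x = 2%N] K ->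
    ~ nat_bss_computable_on [set: seq R] K.
  by apply: contra_not => -[delta [c H]]; exists delta, c => x _; exact: H.
have No := not_computable_Ko UP; have Nd := not_computable_Kd UP.
by split=> //; apply: restrict.
Qed.
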